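(* Let $\theta=(\theta_t)_{t\in\mathbb R}$ be a smooth family of $1$-forms on $\mathbb C$ with $\theta_{t+1}=\theta_t$, and let $\mathcal B\colon\mathcal L^\times\mathbb C\to\mathbb R$ and $\mathcal A\colon T^*\mathcal L^\times\mathbb C\to\mathbb R$ be the associated functionals defined in the context. Then the maps $$\pi(z,\eta)=z,\qquad \iota(z)=\bigl(z,4\|z\|^2z'\bigr)$$ restrict to mutually inverse bijections $\pi\colon\mathrm{Crit}\,\mathcal A\to\mathrm{Crit}\,\mathcal B$ and $\iota\colon\mathrm{Crit}\,\mathcal B\to\mathrm{Crit}\,\mathcal A$.
   Context: Identify $\mathbb C\cong\mathbb R^2$, $\mathbb S^1=\mathbb R/\mathbb Z$; $\|\cdot\|$, $\langle\cdot,\cdot\rangle$ denote the $L^2(\mathbb S^1,\mathbb R^2)$ norm and inner product. $\mathcal L\mathbb C=C^\infty(\mathbb S^1,\mathbb C)$, $\mathcal L^\times\mathbb C=\mathcal L\mathbb C\setminus\{0\}$ (only the zero loop removed; loops may pass through the origin), $T^*\mathcal L^\times\mathbb C=\mathcal L^\times\mathbb C\times\mathcal L\mathbb C$. Let $\varsigma(z)=z^2$, $\vartheta_t:=\varsigma^*\theta_t$, and for $z\in\mathcal L^\times\mathbb C$ put $t_z(\tau)=\|z\|^{-2}\int_0^\tau|z(s)|^2ds$. For $z\in\mathcal L^\times\mathbb C$ and $\xi\in\mathcal L\mathbb C$ set $\Theta_z\xi=\int_0^1\vartheta_{t_z(\tau)}|_{z(\tau)}\xi(\tau)\,d\tau$.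 Define $$\mathcal B(z)=2\|z\|^2\|z'\|^2+\frac1{\|z\|^2}+\Theta_zz',$$ $$\mathcal A(z,\eta)=\langle\eta,z'\rangle+\Theta_zz'-\mathcal H(z,\eta),\qquad \mathcal H(z,\eta)=\frac{\|\eta\|^2}{8\|z\|^2}-\frac1{\|z\|^2}.$$ $\mathrm{Crit}$ denotes the set of points where the differential vanishes on all tangent vectors, i.e. on all $\xi\in\mathcal L\mathbb C$ for $\mathcal B$ and on all $(\hat z,\hat\eta)\in\mathcal L\mathbb C\times\mathcal L\mathbb C$ for $\mathcal A$. *)

(* Defs.v *)
From Stdlib Require Import Reals.
From Coquelicot Require Import Coquelicot.
Open Scope R_scope.

(** C^n maps between real normed modules; [df x] is the differential at [x].
    Requiring [x |-> df x v] to be C^m for each fixed [v] is the usual notion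
    when [V] is finite-dimensional, the only case used below. *)
Fixpoint Ck (n : nat) {V W : NormedModule R_AbsRing} (f : V -> W) : Prop :=
  match n with
  | O => forall x, continuous f x
  | S m => exists df : V -> V -> W,
      (forall x, filterdiff f (locally x) (df x)) /\
      (forall v, Ck m (fun x => df x v))
  end.

Definition smooth {V W : NormedModule R_AbsRing} (f : V -> W) : Prop :=
  forall n, Ck n f.

(** Loops [R/Z -> C] are 1-periodic functions on [R]. *)
Definition loop (z : R -> C) : Prop :=
  smooth (V := R_NormedModule) (W := C_R_NormedModule) z /\
  forall t, z (t + 1) = z t.

Definition nonzero_loop (z : R -> C) : Prop :=
  loop z /\ z <> (fun _ => RtoC 0).

Definition cotangent (p : (R -> C) * (R -> C)) : Prop :=
  nonzero_loop (fst p) /\ loop (snd p).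

(** [z + s xi], for real [s]. *)
Definition shift (z : R -> C) (s : R) (xi : R -> C) : R -> C :=
  fun t => (z t + s * xi t)%C.

Definition deriv (z : R -> C) (t : R) : C :=
  (Derive (fun s => Re (z s)) t, Derive (fun s => Im (z s)) t).

Definition inner (x y : R -> C) : R :=
  RInt (fun t => Re (x t) * Re (y t) + Im (x t) * Im (y t)) 0 1.

Definition L2norm (x : R -> C) : R := sqrt (inner x x).

(** [theta t w v] is the value of the 1-form [theta_t] at the point [w] on the
    tangent vector [v]. Families are smooth jointly in [(t, w)]. *)
Definition smooth_form_family (theta : R -> C -> C -> R) : Prop :=
  (forall t w,
     is_linear (U := C_R_NormedModule) (V := R_NormedModule) (theta t w)) /\
  (forall v : C,
     smooth (V := prod_NormedModule R_AbsRing R_NormedModule C_R_NormedModule)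
            (W := R_NormedModule)
            (fun p => theta (fst p) (snd p) v)).

(** [(f^* alpha)_w (v) = alpha_{f w} (df_w v)]. *)
Definition pullback (f : C -> C) (alpha : C -> C -> R) (w v : C) : R :=
  alpha (f w) (deriv (fun s : R => f (w + s * v)%C) 0).

Definition sq (w : C) : C := (w * w)%C.

Definition vartheta (theta : R -> C -> C -> R) (t : R) : C -> C -> R :=
  pullback sq (theta t).

Definition time (z : R -> C) (tau : R) : R :=
  / L2norm z ^ 2 * RInt (fun s => Cmod (z s) ^ 2) 0 tau.

Definition Theta (theta : R -> C -> C -> R) (z xi : R -> C) : R :=
  RInt (fun tau => vartheta theta (time z tau) (z tau) (xi tau)) 0 1.

Definition functionalB (theta : R -> C -> C -> R) (z : R -> C) : R :=
  2 * L2norm z ^ 2 * L2norm (deriv z) ^ 2 + 1 / L2norm z ^ 2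
  + Theta theta z (deriv z).

Definition hamiltonian (z eta : R -> C) : R :=
  L2norm eta ^ 2 / (8 * L2norm z ^ 2) - 1 / L2norm z ^ 2.

Definition functionalA (theta : R -> C -> C -> R)
    (p : (R -> C) * (R -> C)) : R :=
  inner (snd p) (deriv (fst p)) + Theta theta (fst p) (deriv (fst p))
  - hamiltonian (fst p) (snd p).

(** The differential of a functional at [z] on a tangent vector [xi] is the
    derivative at [s = 0] along [s |-> z + s xi]; this curve stays in the
    nonzero loops for small [s]. *)
Definition CritB (theta : R -> C -> C -> R) (z : R -> C) : Prop :=
  nonzero_loop z /\
  forall xi, loop xi ->
    is_derive (fun s : R => functionalB theta (shift z s xi)) 0 0.

Definition CritA (theta : R -> C -> C -> R)
    (p : (R -> C) * (R -> C)) : Prop :=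
  cotangent p /\
  forall zhat etahat, loop zhat -> loop etahat ->
    is_derive
      (fun s : R =>
         functionalA theta (shift (fst p) s zhat, shift (snd p) s etahat)) 0 0.

Definition proj (p : (R -> C) * (R -> C)) : R -> C := fst p.

Definition incl (z : R -> C) : (R -> C) * (R -> C) :=
  (z, fun t => ((4 * L2norm z ^ 2)%R * deriv z t)%C).

(* Main.v *)
(** Completing the square gives
      [A (z, eta) = B z - 1/2 ||eta / (2 ||z||) - 2 ||z|| z'||^2].
    The square vanishes to second order along [eta = 4 ||z||^2 z'], so on this
    set the differentials of [A] and [B] agree; and the [eta]-component of the
    differential of [A] vanishes exactly on this set. The term [Theta_z z'] is
    common to both functionals and cancels. *)
Require Import Defs.
From Stdlib Require Import Reals Znat Lra Lia Classical FunctionalExtensionality.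
From Coquelicot Require Import Coquelicot.
Open Scope R_scope.

(** * Linear combinations and derivatives of loops *)

Lemma Ck_const {V W : NormedModule R_AbsRing} (n : nat) (c : W) :
  Ck n (fun _ : V => c).
Proof.
  revert c; induction n as [|n IH]; intros c; simpl.
  - intros x; apply continuous_const.
  - exists (fun _ _ => zero); split.
    + intros x; apply filterdiff_const.
    + intros v; apply IH.
Qed.

Lemma Ck_axpy {V W : NormedModule R_AbsRing} (n : nat) (k : R) (f g : V -> W) :
  Ck n f -> Ck n g -> Ck n (fun x => plus (f x) (scal k (g x))).
Proof.
  revert f g; induction n as [|n IH]; simpl; intros f g.
  - intros Hf Hg x.
    apply (continuous_plus (V := W)); [apply Hf|].
    apply (continuous_scal_r (V := W) k g x), Hg.
  - intros [df [Hf Cf]] [dg [Hg Cg]].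
    exists (fun x v => plus (df x v) (scal k (dg x v))); split.
    + intros x.
      apply filterdiff_plus_fct; [apply Hf|].
      apply (filterdiff_scal_r_fct k g (dg x)); [exact Rmult_comm | apply Hg].
    + intros v; exact (IH _ _ (Cf v) (Cg v)).
Qed.

Lemma loop_shift (x y : R -> C) (s : R) :
  loop x -> loop y -> loop (shift x s y).
Proof.
  intros [Sx Px] [Sy Py]; split.
  - intros n.
    replace (shift x s y) with (fun t => plus (x t : C_R_NormedModule)
                                              (scal s (y t : C_R_NormedModule))).
    + apply Ck_axpy; [apply Sx | apply Sy].
    + extensionality t; rewrite scal_R_Cmult; reflexivity.
  - intros t; unfold shift; now rewrite Px, Py.
Qed.

Lemma loop_zero : loop (fun _ => RtoC 0).
Proof.
  split; [intros n; exact (Ck_const n _) | reflexivity].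
Qed.

Lemma is_derive_components (z : R -> C) (l : C) (t : R) :
  is_derive (V := C_R_NormedModule) z t l ->
  is_derive (fun s => Re (z s)) t (Re l) /\
  is_derive (fun s => Im (z s)) t (Im l).
Proof.
  intros H; split.
  - apply (filterdiff_ext_lin _ (fun y : R_NormedModule => fst (scal (y : R) (l : C_R_NormedModule)))).
    + apply (filterdiff_comp' (V := C_R_NormedModule) z (fun c => fst c) t _ fst H).
      apply filterdiff_linear, is_linear_fst.
    + reflexivity.
  - apply (filterdiff_ext_lin _ (fun y : R_NormedModule => snd (scal (y : R) (l : C_R_NormedModule)))).
    + apply (filterdiff_comp' (V := C_R_NormedModule) z (fun c => snd c) t _ snd H).
      apply filterdiff_linear, is_linear_snd.
    + reflexivity.
Qed.

(** A linear map on the real line is determined by its value at 1. This links the abstract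
    differentials occurring in [Ck] with the coordinatewise [deriv]. *)
Lemma filterdiff_deriv (z : R -> C) (dz : R -> C) (t : R) :
  filterdiff (V := C_R_NormedModule) z (locally t) dz -> dz 1 = deriv z t.
Proof.
  intros H.
  assert (D : is_derive (V := C_R_NormedModule) z t (dz 1)).
  { refine (filterdiff_ext_lin _ _ _ H _); intros y.
    rewrite <- (linear_scal _ (proj1 H)).
    f_equal; symmetry; exact (Rmult_1_r y). }
  destruct (is_derive_components _ _ _ D) as [D1 D2].
  apply injective_projections; symmetry; now apply is_derive_unique.
Qed.

Lemma loop_ex_derive (z : R -> C) (t : R) :
  loop z ->
  ex_derive (fun s => Re (z s)) t /\ ex_derive (fun s => Im (z s)) t.
Proof.
  intros [S _].
  destruct (S 1%nat) as [dz [H _]].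
  assert (D : is_derive (V := C_R_NormedModule) z t (dz t 1)).
  { refine (filterdiff_ext_lin _ _ _ (H t) _); intros y.
    rewrite <- (linear_scal _ (proj1 (H t))).
    f_equal; symmetry; exact (Rmult_1_r y). }
  destruct (is_derive_components _ _ _ D) as [D1 D2].
  split; eexists; eassumption.
Qed.

Lemma Derive_periodic (f : R -> R) (T t : R) :
  (forall u, f (u + T) = f u) -> Derive f (t + T) = Derive f t.
Proof.
  intros P; unfold Derive; f_equal; apply Lim_ext; intros h.
  replace (t + T + h) with (t + h + T) by ring; now rewrite !P.
Qed.

(** A differential witnessing [Ck (S n)], taken in the direction 1, is [Ck n] and equals [deriv z].
    Periodicity passes to difference quotients. *)
Lemma loop_deriv (z : R -> C) : loop z -> loop (deriv z).
Proof.
  intros [S P]; split.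
  - intros n; destruct (S (Datatypes.S n)) as [dz [H C]].
    replace (deriv z) with (fun t => dz t 1); [apply C|].
    extensionality t; apply filterdiff_deriv, H.
  - intros t; unfold deriv; f_equal; apply Derive_periodic; intros u; now rewrite P.
Qed.

Lemma deriv_shift (z xi : R -> C) (s : R) :
  loop z -> loop xi -> deriv (shift z s xi) = shift (deriv z) s (deriv xi).
Proof.
  intros Hz Hx; extensionality t.
  destruct (loop_ex_derive z t Hz) as [Z1 Z2].
  destruct (loop_ex_derive xi t Hx) as [X1 X2].
  unfold deriv, shift.
  apply injective_projections; simpl.
  - rewrite (Derive_ext _ (fun u => Re (z u) + s * Re (xi u)))
      by (intros u; unfold Re, Im; simpl; ring).
    rewrite Derive_plus, Derive_scal by auto using ex_derive_scal.
    unfold Re, Im; ring.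
  - rewrite (Derive_ext _ (fun u => Im (z u) + s * Im (xi u)))
      by (intros u; unfold Re, Im; simpl; ring).
    rewrite Derive_plus, Derive_scal by auto using ex_derive_scal.
    unfold Re, Im; ring.
Qed.

(** * The inner product on loops *)

Lemma continuous_inner (x y : R -> C) (t : R) :
  loop x -> loop y ->
  continuous (fun t => Re (x t) * Re (y t) + Im (x t) * Im (y t)) t.
Proof.
  intros Hx Hy.
  destruct (loop_ex_derive x t Hx) as [X1 X2].
  destruct (loop_ex_derive y t Hy) as [Y1 Y2].
  apply (ex_derive_continuous
           (fun t => Re (x t) * Re (y t) + Im (x t) * Im (y t))).
  apply (ex_derive_plus (fun t => Re (x t) * Re (y t))
                        (fun t => Im (x t) * Im (y t)));
    now apply ex_derive_mult.
Qed.

Lemma ex_RInt_inner (x y : R -> C) (a b : R) :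
  loop x -> loop y ->
  ex_RInt (fun t => Re (x t) * Re (y t) + Im (x t) * Im (y t)) a b.
Proof.
  intros Hx Hy; apply (ex_RInt_continuous (V := R_CompleteNormedModule)).
  intros t _; now apply continuous_inner.
Qed.

Lemma inner_sym (x y : R -> C) : inner x y = inner y x.
Proof.
  unfold inner; f_equal; extensionality t; ring.
Qed.

Lemma inner_shift_r (x y z : R -> C) (s : R) :
  loop x -> loop y -> loop z ->
  inner x (shift y s z) = inner x y + s * inner x z.
Proof.
  intros Hx Hy Hz; unfold inner.
  rewrite <- (RInt_scal (V := R_CompleteNormedModule)) by now apply ex_RInt_inner.
  rewrite <- (RInt_plus (V := R_CompleteNormedModule)).
  - apply RInt_ext; intros t _; unfold shift, Re, Im, plus, scal; simpl.
    unfold mult; simpl; refine (_ : @eq R _ _); ring.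
  - now apply ex_RInt_inner.
  - apply (ex_RInt_scal (V := R_NormedModule)); now apply ex_RInt_inner.
Qed.

Lemma inner_shift (x y u v : R -> C) (s : R) :
  loop x -> loop y -> loop u -> loop v ->
  inner (shift x s y) (shift u s v) =
  inner x u + s * (inner x v + inner y u) + s ^ 2 * inner y v.
Proof.
  intros Hx Hy Hu Hv.
  rewrite inner_shift_r by auto using loop_shift.
  rewrite !(inner_sym (shift x s y)), !inner_shift_r by auto.
  rewrite (inner_sym u x), (inner_sym u y), (inner_sym v x), (inner_sym v y).
  ring.
Qed.

Lemma L2norm_sq (x : R -> C) : loop x -> L2norm x ^ 2 = inner x x.
Proof.
  intros Hx; apply pow2_sqrt, RInt_ge_0; [lra | now apply ex_RInt_inner |].
  intros t _; nra.
Qed.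

(** Moves any point into the interval over which [inner] integrates, so that vanishing there implies
    vanishing on all of [R]. *)
Lemma loop_frac_part (z : R -> C) (t : R) : loop z -> z (frac_part t) = z t.
Proof.
  intros [_ P].
  assert (PN : forall (n : nat) u, z (u + INR n) = z u).
  { induction n as [|n IH]; intros u.
    - now rewrite Rplus_0_r.
    - rewrite S_INR, <- Rplus_assoc, P; apply IH. }
  (* [PN] only adds periods: a nonnegative integer part is added back to the fractional part, while
     for a negative one its opposite is added to [t]. *)
  unfold frac_part; destruct (Z.le_gt_cases 0 (Int_part t)) as [H|H].
  - rewrite <- (PN (Z.to_nat (Int_part t)) (t - _)), INR_IZR_INZ, Z2Nat.id by auto.
    f_equal; ring.
  - rewrite <- (PN (Z.to_nat (- Int_part t)) t), INR_IZR_INZ, Z2Nat.id, opp_IZR.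
    + reflexivity.
    + lia.
Qed.

(** A continuous nonnegative integrand that is positive somewhere on [0, 1) has positive integral;
    periodicity covers the rest of the line. This is what permits division by [||z||^2]. *)
Lemma inner_pos (z : R -> C) : nonzero_loop z -> 0 < inner z z.
Proof.
  intros [L NZ].
  set (g := fun t => Re (z t) * Re (z t) + Im (z t) * Im (z t)).
  assert (G0 : forall t, 0 <= g t) by (intros t; unfold g; nra).
  assert (I : forall a b, ex_RInt g a b) by (intros; now apply ex_RInt_inner).
  destruct (Rle_or_lt (inner z z) 0) as [Hle|]; [exfalso | assumption].
  apply NZ; extensionality t; rewrite <- (loop_frac_part z t L).
  destruct (base_fp t) as [T0 T1]; set (u := frac_part t) in *.
  assert (Hu : g u <= 0).
  { apply Rnot_lt_le; intros Hu.
    destruct (continuous_inner z z u L L (fun y => 0 < y)) as [d Hd].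
    { exact (open_gt 0 _ Hu). }
    pose proof (cond_pos d) as Dp.
    (* Only points to the right of [u] are used: since [u < 1], the interval from [u] to [b] is
       nondegenerate and stays in [0, 1], even for [u = 0]. *)
    set (b := Rmin (u + d) 1).
    assert (ub : u < b) by (apply Rmin_glb_lt; lra).
    assert (b1 : b <= 1) by apply Rmin_r.
    assert (bd : b <= u + d) by apply Rmin_l.
    assert (E : inner z z = RInt g 0 u + (RInt g u b + RInt g b 1)).
    { unfold inner; fold g.
      rewrite <- (RInt_Chasles g 0 u 1), <- (RInt_Chasles g u b 1) by auto.
      reflexivity. }
    assert (0 <= RInt g 0 u) by (apply RInt_ge_0; auto; lra).
    assert (0 <= RInt g b 1) by (apply RInt_ge_0; auto; lra).
    assert (0 < RInt g u b).
    { apply RInt_gt_0; [assumption | |].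
      - intros x Hx; apply Hd.
        apply Rabs_lt_between'; lra.
      - intros x _; now apply continuous_inner. }
    lra. }
  unfold g in Hu; unfold Re, Im in Hu.
  apply injective_projections; simpl; nra.
Qed.

(** * Comparison of the two functionals and of their critical points *)

Lemma shift_zero (z : R -> C) (s : R) : shift z s (fun _ => RtoC 0) = z.
Proof.
  extensionality t; unfold shift; ring.
Qed.

Lemma L2norm_sq_shift (x y : R -> C) (s : R) :
  loop x -> loop y ->
  L2norm (shift x s y) ^ 2 = inner x x + s * (2 * inner x y) + s ^ 2 * inner y y.
Proof.
  intros Hx Hy; rewrite L2norm_sq by now apply loop_shift.
  rewrite inner_shift, (inner_sym y x) by auto; ring.
Qed.

(** As a shift of the zero loop, the fibre component falls under the lemmas on [shift], which give
    its smoothness and its pairings. *)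
Lemma incl_eq (z : R -> C) :
  loop z ->
  snd (incl z) = shift (fun _ => RtoC 0) (4 * inner z z) (deriv z).
Proof.
  intros Hz; extensionality t; unfold incl, shift; cbn [snd].
  rewrite L2norm_sq by assumption; ring.
Qed.

Lemma loop_snd_incl (z : R -> C) : loop z -> loop (snd (incl z)).
Proof.
  intros Hz; rewrite incl_eq by assumption.
  auto using loop_shift, loop_zero, loop_deriv.
Qed.

Lemma inner_incl (z x : R -> C) :
  loop z -> loop x ->
  inner x (snd (incl z)) = 4 * inner z z * inner x (deriv z).
Proof.
  intros Hz Hx.
  rewrite incl_eq, inner_shift_r by auto using loop_zero, loop_deriv.
  replace (inner x (fun _ => RtoC 0)) with 0; [ring|].
  unfold inner.
  rewrite (RInt_ext _ (fun _ => 0)) by (intros t _; simpl; ring).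
  rewrite RInt_const; symmetry; apply Rmult_0_r.
Qed.

(** Both directions are arbitrary, so this single computation transfers criticality from A to B and
    from B to A. *)
Lemma is_derive_functional_diff (theta : R -> C -> C -> R)
    (z zhat etahat : R -> C) :
  nonzero_loop z -> loop zhat -> loop etahat ->
  is_derive
    (fun s => functionalA theta (shift z s zhat, shift (snd (incl z)) s etahat)
              - functionalB theta (shift z s zhat)) 0 0.
Proof.
  intros Nz Hh He; pose proof (inner_pos z Nz) as Pos; destruct Nz as [Hz _].
  pose proof (loop_snd_incl z Hz) as Hi.
  pose proof (loop_deriv z Hz) as Hz'; pose proof (loop_deriv zhat Hh) as Hh'.
  set (eta := snd (incl z)) in *.
  (* These identities replace [eta] by [4 ||z||^2 z'] in every pairing that enters the derivative at
     0. *)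
  assert (E1 : forall x, loop x -> inner x eta = 4 * inner z z * inner x (deriv z))
    by (intros; now apply inner_incl).
  assert (E2 : inner eta etahat = 4 * inner z z * inner etahat (deriv z))
    by (rewrite inner_sym; auto).
  assert (E3 : inner eta (deriv zhat) = 4 * inner z z * inner (deriv z) (deriv zhat))
    by (rewrite inner_sym, E1, (inner_sym (deriv z)); auto).
  assert (E4 : inner eta (deriv z) = 4 * inner z z * inner (deriv z) (deriv z))
    by (rewrite inner_sym; auto).
  (* Along the curve, [a], [b] and [d] are the squared norms of the loop, of its derivative and of
     the fibre component; [c] pairs the last two. *)
  set (a s := inner z z + s * (2 * inner z zhat) + s ^ 2 * inner zhat zhat).
  set (b s := inner (deriv z) (deriv z) + s * (2 * inner (deriv z) (deriv zhat))
              + s ^ 2 * inner (deriv zhat) (deriv zhat)).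
  set (c s := inner eta (deriv z)
              + s * (inner eta (deriv zhat) + inner etahat (deriv z))
              + s ^ 2 * inner etahat (deriv zhat)).
  set (d s := inner eta eta + s * (2 * inner eta etahat)
              + s ^ 2 * inner etahat etahat).
  (* The [Theta] terms and the terms [1 / a] cancel in the difference. *)
  apply (is_derive_ext (fun s => c s - d s / (8 * a s) - 2 * a s * b s)).
  - intros s; unfold functionalA, functionalB, hamiltonian; cbn [fst snd].
    rewrite deriv_shift, inner_shift, !L2norm_sq_shift by assumption.
    fold (a s) (b s) (c s) (d s).
    refine (_ : @eq R _ _); unfold Rdiv; ring.
  (* At 0, [d = 16 a^2 b], so [d a' / (8 a^2)] cancels [2 a' b]. The [etahat] part of [c'] cancels
     [d' / (8 a)], and the rest of [c'] cancels [2 a b']. *)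
  - unfold a, b, c, d; auto_derive; [lra|].
    rewrite (E1 eta), E2, E3, E4 by assumption; field; lra.
Qed.

(** Only variations of [eta] with [z] fixed are needed. Testing against the gradient of A in the
    fibre direction gives its squared norm, which must therefore vanish. *)
Lemma CritA_eta (theta : R -> C -> C -> R) (p : (R -> C) * (R -> C)) :
  CritA theta p -> incl (fst p) = p.
Proof.
  destruct p as [z eta]; intros [[Nz He] H]; simpl in *.
  pose proof (inner_pos z Nz) as Pos; pose proof (proj1 Nz) as Hz.
  pose proof (loop_deriv z Hz) as Hz'.
  (* The fibre gradient is [w = z' - eta / (4 ||z||^2)]. *)
  set (k := - / (4 * inner z z)).
  set (w := shift (deriv z) k eta).
  assert (Hw : loop w) by now apply loop_shift.
  assert (W1 : inner w w = inner w (deriv z) + k * inner w eta)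
    by (unfold w at 2; now apply inner_shift_r).
  assert (W : inner w w = 0).
  { specialize (H _ w loop_zero Hw).
    rewrite <- (is_derive_unique _ _ _ H); symmetry; apply is_derive_unique.
    unfold functionalA, hamiltonian; cbn [fst snd].
    apply (is_derive_ext (fun s =>
      inner (deriv z) eta + s * inner (deriv z) w + Theta theta z (deriv z)
      - ((inner eta eta + s * (2 * inner eta w) + s ^ 2 * inner w w)
           / (8 * inner z z) - 1 / inner z z))).
    - intros s.
      rewrite shift_zero, (inner_sym (shift eta s w)), inner_shift_r,
        L2norm_sq_shift, L2norm_sq by assumption.
      reflexivity.
    - auto_derive; [lra|].
      rewrite W1, (inner_sym w (deriv z)), (inner_sym w eta); unfold k; field; lra. }
  unfold incl; f_equal; extensionality t.
  rewrite L2norm_sq by assumption.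
  assert (W0 : w = fun _ => RtoC 0).
  { destruct (classic (w = fun _ => RtoC 0)) as [|NW]; [assumption|].
    pose proof (inner_pos w (conj Hw NW)); lra. }
  assert (Wt : w t = RtoC 0) by now rewrite W0.
  (* Multiplying [w t = 0] by [4 ||z||^2] yields [4 ||z||^2 z' - eta = 0] at [t]. *)
  apply (f_equal (fun c => (RtoC (4 * inner z z) * c)%C)) in Wt.
  unfold w, shift in Wt.
  rewrite Cmult_plus_distr_l, Cmult_assoc, <- RtoC_mult in Wt.
  replace (4 * inner z z * k) with (- (1)) in Wt by (unfold k; field; lra).
  replace (RtoC (4 * inner z z) * deriv z t)%C
    with ((RtoC (4 * inner z z) * deriv z t + RtoC (- (1)) * eta t) + eta t)%C
    by (rewrite (RtoC_opp 1); ring).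
  rewrite Wt; ring.
Qed.

Theorem theorem2 :
  forall theta : R -> C -> C -> R,
    smooth_form_family theta ->
    (forall (t : R) (w v : C), theta (t + 1) w v = theta t w v) ->
    (forall p, CritA theta p -> CritB theta (proj p)) /\
    (forall z, CritB theta z -> CritA theta (incl z)) /\
    (forall p, CritA theta p -> incl (proj p) = p) /\
    (forall z, CritB theta z -> proj (incl z) = z).
Proof.
  intros theta _ _; split; [|split; [|split]].
  - intros p Hp; pose proof (CritA_eta theta p Hp) as E.
    destruct Hp as [[Nz _] H]; split; [exact Nz|]; intros xi Hxi.
    (* The tangent vector [xi] is lifted to [(xi, 0)], and B is written as A minus the difference A
       - B; [E] identifies the two base points. *)
    pose proof (is_derive_functional_diff theta _ _ _ Nz Hxi loop_zero) as D.
    specialize (H _ _ Hxi loop_zero); rewrite E in D.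
    pose proof (is_derive_minus _ _ _ _ _ H D) as HD.
    rewrite minus_eq_zero in HD.
    refine (is_derive_ext _ _ _ _ _ HD); intros s.
    unfold proj, minus, plus, opp; simpl.
    refine (_ : @eq R _ _); ring.
  - intros z [Nz H]; pose proof (proj1 Nz) as Hz.
    split; [split; [exact Nz | now apply loop_snd_incl]|].
    intros zhat etahat Hzh Heh.
    (* Conversely, A is B plus the difference A - B, and both have zero derivative. *)
    pose proof (is_derive_functional_diff theta _ _ _ Nz Hzh Heh) as D.
    pose proof (is_derive_plus _ _ _ _ _ (H _ Hzh) D) as HD.
    eapply is_derive_ext; [|evar_last; [exact HD | apply Rplus_0_l]]; intros s.
    unfold plus; simpl; refine (_ : @eq R _ _); ring.
  - intros p Hp; exact (CritA_eta theta p Hp).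
  - reflexivity.
Qed.
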